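(* Assume that the map $(x,u)\mapsto\operatorname{tr}(\Sigma^m(x,u)\Sigma^m(x,u)^{\mathsf T})$ is upper bounded in $x$ and $u$ (for all $m\in\mathcal M$), and let $\bar a$ be an upper bound. Assume also that $\delta^m$ is lower bounded for all $m\in\mathcal M$. Then, for $k$ such that $\bar a\le4k+2$: (i) $\mathcal K$ is monotone in the following sense (of Barles and Jakobsen): there exist $\lambda,\mu\ge0$ and $h_0>0$ such that if $h\le h_0$, $v,v'$ are bounded continuous functions from $\overline{\mathcal T}_h\times\mathbb R^d$ to $\mathbb R$ with $v\le v'$, and $\theta(t)=e^{\mu(T-t)}(a+b(T-t))+c$ with $a,b,c\ge0$, then for all $r\in\mathbb R$ and $(t,x)\in\mathcal T_h\times\mathbb R^d$, $$\mathcal K(h,t,x,r+\theta(t),v+\theta)\ \ge\ \mathcal K(h,t,x,r,v')+\frac b2-\lambda c .$$ (ii) There exists $h_0>0$ such that, for $h\le h_0$, the operator $T_{t,h}$ is monotone over the set of bounded continuous functions $\mathbb R^d\to\mathbb R$, that is, $\phi\le\phi'$ implies $T_{t,h}(\phi)\le T_{t,h}(\phi')$.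
   Context: **Data.** $\mathcal M$ is a finite set, $\mathcal U\subset\mathbb R^p$, $T>0$. For $m\in\mathcal M$, the maps $f^m:\mathbb R^d\times\mathcal U\to\mathbb R^d$, $\sigma^m:\mathbb R^d\times\mathcal U\to\mathbb R^{d\times d}$, $\delta^m,\ell^m:\mathbb R^d\times\mathcal U\to\mathbb R$ are continuous. **Decomposition.** For $m\in\mathcal M$, $\underline f^m:\mathbb R^d\to\mathbb R^d$ and $\underline\sigma^m:\mathbb R^d\to\mathbb R^{d\times d}$ are such that $a^m(x)=\underline\sigma^m(x)\underline\sigma^m(x)^{\mathsf T}$ is positive definite and $a^m(x)\le\sigma^m(x,u)\sigma^m(x,u)^{\mathsf T}$ (Loewner order) for all $x,u$. $\Sigma^m(x,u)$ is any $d\times\ell$ matrix (for some integer $\ell$) and $g^m(x,u)\in\mathbb R^d$ is the vector such that $$\sigma^m(x,u)\sigma^m(x,u)^{\mathsf T}-a^m(x)=\underline\sigma^m(x)\Sigma^m(x,u)\Sigma^m(x,u)^{\mathsf T}\underline\sigma^m(x)^{\mathsf T},\qquad f^m(x,u)-\underline f^m(x)=\underline\sigma^m(x)g^m(x,u).$$ **Scheme.** $h>0$ is such that $T/h$ is an integer, $\mathcal T_h=\{0,h,\dots,T-h\}$, $\overline{\mathcal T}_h=\{0,h,\dots,T\}$. $(W_s)$ is a $d$-dimensional Brownian motion and $\hat X^m(t+h)=\hat X^m(t)+\underline f^m(\hat X^m(t))h+\underline\sigma^m(\hat X^m(t))(W_{t+h}-W_t)$. $k\ge0$ is an integer. For $g,w\in\mathbb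 R^d$, $\mathcal P^1_g(w)=2(g_+\cdot w_++g_-\cdot w_-)$, with componentwise positive and negative parts $[\mu_+]_i=\max([\mu]_i,0)$, $[\mu_-]_i=-\min([\mu]_i,0)$. For $\Sigma\in\mathbb R^{d\times\ell}$ with columns $\Sigma_{.j}$, $$\mathcal P^2_{\Sigma,k}(w)=\sum_{j=1}^\ell\|\Sigma_{.j}\|_2^2\Big(c_k\Big(\tfrac{[\Sigma^{\mathsf T}w]_j}{\|\Sigma_{.j}\|_2}\Big)^{4k+2}-d_k\Big),\quad c_k=\tfrac1{(4k+2)\mathbb E[N^{4k+2}]},\quad d_k=\tfrac1{4k+2},$$ $N$ a standard normal variable, the $j$th term being zero if $\|\Sigma_{.j}\|_2=0$. For $\phi:\overline{\mathcal T}_h\times\mathbb R^d\to\mathbb R$, $(t,x)\in\mathcal T_h\times\mathbb R^d$, $r\in\mathbb R$: \begin{align*} \mathcal D^0_{t,h,m}(\phi)(t,x)&=\mathbb E[\phi(t+h,\hat X^m(t+h))\mid\hat X^m(t)=x],\\ \mathcal D^1_{t,h,m,g}(r,\phi)(t,x)&=\mathbb E[(\phi(t+h,\hat X^m(t+h))-r)\mathcal P^1_g(h^{-1}(W_{t+h}-W_t))\mid\hat X^m(t)=x],\\ \mathcal D^2_{t,h,m,\Sigma,k}(\phi)(t,x)&=h^{-1}\mathbb E[\phi(t+h,\hat X^m(t+h))\mathcal P^2_{\Sigma,k}(h^{-1/2}(W_{t+h}-W_t))\mid\hat X^m(t)=x], \end{align*} \begin{align*} \mathcal K(h,t,x,r,\phi)=-\max_{m\in\mathcal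 M,\,u\in\mathcal U}\Big\{&h^{-1}(\mathcal D^0_{t,h,m}(\phi)(t,x)-r)+\ell^m(x,u)-\delta^m(x,u)r\\ &+\mathcal D^1_{t,h,m,g^m(x,u)}(r,\phi)(t,x)+\mathcal D^2_{t,h,m,\Sigma^m(x,u),k}(\phi)(t,x)\Big\}. \end{align*} **Operator $T_{t,h}$.** For $\phi:\mathbb R^d\to\mathbb R$, with the same operators $\mathcal D^i$ applied with $\phi(\hat X^m(t+h))$ in place of $\phi(t+h,\hat X^m(t+h))$, $$T_{t,h}(\phi)(x)=\max_{m\in\mathcal M,\,u\in\mathcal U}\frac{T^N_{t,h,m,u}(\phi)(x)}{T^D_{t,h,m,u}(x)},$$ \begin{align*} T^N_{t,h,m,u}(\phi)(x)&=\mathcal D^0_{t,h,m}(\phi)(t,x)+h\big\{\ell^m(x,u)+\mathcal D^1_{t,h,m,g^m(x,u)}(0,\phi)(t,x)+\mathcal D^2_{t,h,m,\Sigma^m(x,u),k}(\phi)(t,x)\big\},\\ T^D_{t,h,m,u}(x)&=1+h\delta^m(x,u)+h\,\mathbb E[\mathcal P^1_{g^m(x,u)}(h^{-1}(W_{t+h}-W_t))]. \end{align*} The maxima over $\mathcal U$ are implicitly assumed to be attained. *)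

(* Defs.v *)
From HB Require Import structures.
From mathcomp Require Import all_boot all_order all_algebra.
From mathcomp Require Import all_classical all_reals all_analysis.

Set Implicit Arguments.
Unset Strict Implicit.
Unset Printing Implicit Defensive.

Import Order.TTheory GRing.Theory Num.Theory.
Import numFieldNormedType.Exports.

Local Open Scope classical_set_scope.
Local Open Scope ring_scope.

Definition dot (R : realType) (d : nat) (v w : 'cV[R]_d) : R :=
  \sum_i v i 0 * w i 0.

Definition norm2 (R : realType) (d : nat) (v : 'cV[R]_d) : R :=
  Num.sqrt (dot v v).

Definition posdef (R : realType) (d : nat) (A : 'M[R]_d) : Prop :=
  A^T = A /\ forall v : 'cV[R]_d, v != 0 -> 0 < dot v (A *m v).

Definition loewner_le (R : realType) (d : nat) (A B : 'M[R]_d) : Prop :=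
  forall v : 'cV[R]_d, 0 <= dot v ((B - A) *m v).

Definition has_max (R : realType) (A : set R) : Prop :=
  exists2 y, A y & ubound A y.

(* Meaningful only when [has_max A]; otherwise the value is 0. *)
Definition max_of (R : realType) (A : set R) : R := xget 0 (A `&` ubound A).

(* The B i range over all Borel sets, including setT, so the product rule for
   the whole family gives it for every subfamily. *)
Definition mutually_independent (R : realType) (disp : measure_display)
    (Om : measurableType disp) (P : probability Om R)
    (I : finType) (X : I -> Om -> R) : Prop :=
  forall B : I -> set R, (forall i, measurable (B i)) ->
    P (\bigcap_i (X i @^-1` B i)) = (\prod_i P (X i @^-1` B i))%E.

(* The scalar increments are indexed by (time step, coordinate), so that
   independence holds both across disjoint time intervals and across the
   coordinates. *)
Definition brownian_motion (R : realType) (disp : measure_display)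
    (Om : measurableType disp) (P : probability Om R) (d : nat)
    (W : R -> Om -> 'cV[R]_d) : Prop :=
  [/\ forall t i, 0 <= t -> measurable_fun setT (fun om => W t om i 0),
      {ae P, forall om, W 0 om = 0},
      {ae P, forall om, {within `[0, +oo[, continuous (fun t => W t om)}},
      forall (n : nat) (s : nat -> R), 0 <= s 0%N ->
        (forall j, s j <= s j.+1) ->
        mutually_independent P (fun (ji : 'I_n * 'I_d) om =>
          W (s ji.1.+1) om ji.2 0 - W (s ji.1) om ji.2 0)
    & forall s t i (B : set R), 0 <= s -> s < t -> measurable B ->
        P ((fun om => W t om i 0 - W s om i 0) @^-1` B) =
        normal_prob 0 (Num.sqrt (t - s)) B].

(* Only the values at controls u in [ctrl] are meaningful. *)
Record problem (R : realType) (M : finType) (d p : nat) := Problem {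
  ctrl : set 'cV[R]_p;
  drift : M -> 'cV[R]_d -> 'cV[R]_p -> 'cV[R]_d;
  vol : M -> 'cV[R]_d -> 'cV[R]_p -> 'M[R]_d;
  disc : M -> 'cV[R]_d -> 'cV[R]_p -> R;
  cost : M -> 'cV[R]_d -> 'cV[R]_p -> R
}.

Definition continuous_problem (R : realType) (M : finType) (d p : nat)
    (pb : problem R M d p) : Prop :=
  forall m,
  [/\ {within setT `*` ctrl pb,
        continuous (fun z : 'cV[R]_d * 'cV[R]_p => drift pb m z.1 z.2)},
      {within setT `*` ctrl pb,
        continuous (fun z : 'cV[R]_d * 'cV[R]_p => vol pb m z.1 z.2)},
      {within setT `*` ctrl pb,
        continuous (fun z : 'cV[R]_d * 'cV[R]_p => disc pb m z.1 z.2)}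
    & {within setT `*` ctrl pb,
        continuous (fun z : 'cV[R]_d * 'cV[R]_p => cost pb m z.1 z.2)}].

(* drift0, vol0 are the uncontrolled coefficients, Sig and gvec the matrices
   Sigma^m(x,u) and vectors g^m(x,u). *)
Record decomposition (R : realType) (M : finType) (d p q : nat) :=
  Decomposition {
  drift0 : M -> 'cV[R]_d -> 'cV[R]_d;
  vol0 : M -> 'cV[R]_d -> 'M[R]_d;
  Sig : M -> 'cV[R]_d -> 'cV[R]_p -> 'M[R]_(d, q);
  gvec : M -> 'cV[R]_d -> 'cV[R]_p -> 'cV[R]_d
}.

Definition decomposes (R : realType) (M : finType) (d p q : nat)
    (pb : problem R M d p) (dc : decomposition R M d p q) : Prop :=
  forall m x,
  let s0 := vol0 dc m x in
  let a := s0 *m s0^T in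
  posdef a /\
  forall u, ctrl pb u ->
  let s := vol pb m x u in
  let S := Sig dc m x u in
  [/\ loewner_le a (s *m s^T),
      s *m s^T - a = s0 *m S *m S^T *m s0^T
    & drift pb m x u - drift0 dc m x = s0 *m gvec dc m x u].

Definition time_grid (R : realType) (T h : R) : set R :=
  [set t | exists n : nat, t = n%:R * h /\ t <= T - h].

Definition closed_time_grid (R : realType) (T h : R) : set R :=
  [set t | exists n : nat, t = n%:R * h /\ t <= T].

Definition bounded_continuous (R : realType) (d : nat)
    (phi : 'cV[R]_d -> R) : Prop :=
  continuous phi /\ exists C : R, forall x, `|phi x| <= C.

Definition grid_bounded_continuous (R : realType) (d : nat) (T h : R)
    (v : R -> 'cV[R]_d -> R) : Prop :=
  {within closed_time_grid T h `*` setT,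
    continuous (fun z : R * 'cV[R]_d => v z.1 z.2)} /\
  exists C : R, forall t x, closed_time_grid T h t -> `|v t x| <= C.

Definition pos_part (R : realType) (d : nat) (v : 'cV[R]_d) : 'cV[R]_d :=
  \col_i Num.max (v i 0) 0.

Definition neg_part (R : realType) (d : nat) (v : 'cV[R]_d) : 'cV[R]_d :=
  \col_i - Num.min (v i 0) 0.

Definition P1 (R : realType) (d : nat) (g w : 'cV[R]_d) : R :=
  2 * (dot (pos_part g) (pos_part w) + dot (neg_part g) (neg_part w)).

Definition coef_c (R : realType) (k : nat) : R :=
  ((4 * k + 2)%:R *
   fine 'E_(normal_prob (0 : R) 1)[fun x => x ^+ (4 * k + 2)])^-1.

Definition coef_d (R : realType) (k : nat) : R := (4 * k + 2)%:R^-1.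

Definition P2 (R : realType) (d q k : nat) (S : 'M[R]_(d, q))
    (w : 'cV[R]_d) : R :=
  \sum_(j < q)
    let nj := norm2 (col j S) in
    if nj == 0 then 0
    else nj ^+ 2 *
      (coef_c R k * ((S^T *m w) j 0 / nj) ^+ (4 * k + 2) - coef_d R k).

Section Scheme.
Context (R : realType) (disp : measure_display) (Om : measurableType disp)
  (P : probability Om R) (M : finType) (d p q : nat)
  (pb : problem R M d p) (dc : decomposition R M d p q)
  (W : R -> Om -> 'cV[R]_d) (k : nat).
Implicit Types (h t r : R) (m : M) (x : 'cV[R]_d) (u : 'cV[R]_p).

Definition incr t h (om : Om) : 'cV[R]_d := W (t + h) om - W t om.

(* The state at time t + h of the Euler chain which is at x at time t. *)
Definition euler_step t h m x (om : Om) : 'cV[R]_d :=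
  x + h *: drift0 dc m x + vol0 dc m x *m incr t h om.

(* In D0, D1, D2 the expectation given that the chain is at x at time t is the
   one given by its transition kernel: the increment is independent of the
   past, so it is the expectation for the step started from x.  The argument
   psi stands for phi(t+h, .), or for phi when phi does not depend on time. *)
Definition D0 t h m (psi : 'cV[R]_d -> R) x : R :=
  fine 'E_P[fun om => psi (euler_step t h m x om)].

Definition D1 t h m (g : 'cV[R]_d) r (psi : 'cV[R]_d -> R) x : R :=
  fine 'E_P[fun om =>
    (psi (euler_step t h m x om) - r) * P1 g (h^-1 *: incr t h om)].

Definition D2 t h m (S : 'M[R]_(d, q)) (psi : 'cV[R]_d -> R) x : R :=
  h^-1 * fine 'E_P[fun om =>
    psi (euler_step t h m x om) *
    P2 k S ((Num.sqrt h)^-1 *: incr t h om)].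

Definition K_values h t x r (phi : R -> 'cV[R]_d -> R) : set R :=
  [set y | exists m, exists2 u, ctrl pb u &
    y = h^-1 * (D0 t h m (phi (t + h)) x - r)
        + cost pb m x u - disc pb m x u * r
        + D1 t h m (gvec dc m x u) r (phi (t + h)) x
        + D2 t h m (Sig dc m x u) (phi (t + h)) x].

Definition K h t x r (phi : R -> 'cV[R]_d -> R) : R :=
  - max_of (K_values h t x r phi).

Definition TN t h m u (phi : 'cV[R]_d -> R) x : R :=
  D0 t h m phi x
  + h * (cost pb m x u + D1 t h m (gvec dc m x u) 0 phi x
         + D2 t h m (Sig dc m x u) phi x).

Definition TD t h m u x : R :=
  1 + h * disc pb m x u
  + h * fine 'E_P[fun om => P1 (gvec dc m x u) (h^-1 *: incr t h om)].

Definition T_values t h (phi : 'cV[R]_d -> R) x : set R :=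
  [set y | exists m, exists2 u, ctrl pb u &
    y = TN t h m u phi x / TD t h m u x].

Definition T_op t h (phi : 'cV[R]_d -> R) x : R :=
  max_of (T_values t h phi x).

End Scheme.

(* Main.v *)
Require Import Defs.
From HB Require Import structures.
From mathcomp Require Import all_boot all_order all_algebra.
From mathcomp Require Import all_classical all_reals all_analysis.
From mathcomp Require Import measurable_realfun lra ring.

Set Implicit Arguments.
Unset Strict Implicit.
Unset Printing Implicit Defensive.

Import Order.TTheory GRing.Theory Num.Theory.
Import numFieldNormedType.Exports.

Local Open Scope classical_set_scope.
Local Open Scope ring_scope.

(** Each bracket under the maximum is, up to a positive factor and terms free
    of the test function, the expectation of phi(X(t+h)) against the random
    weight [1 + h A + B], where X is the Euler chain, A is the P1 weight of the scaled
    increment and B its P2 weight.  This weight is nonnegative: A >= 0 by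
    inspection, and B is bounded below by [- d_k * tr (Sig Sig^T)], because an
    even power is nonnegative; the condition [abar <= 4k+2] is exactly what
    makes this bound at least -1 ([P2_geN1]).  Hence every bracket is monotone
    in the test function ([expectation_weight_le]).

    For (ii) it remains to see that the denominators are positive for small h,
    which follows from [E A >= 0] and the lower bound on the discount
    ([TD_gt0]); a maximum of monotone quantities is monotone.

    For (i), adding theta(t+h) to the test function and theta(t) to r changes a
    bracket by [(theta(t+h) - theta(t)) (1/h + E A) - delta theta(t)
    + theta(t+h) (E B) / h].  The last term is harmful unless [E B = 0], and
    the normalization of c_k and d_k gives exactly this ([expectation_P2]).
    Since theta is nonincreasing the E A term can be dropped, and with
    -C a lower bound of the discount, the choice mu = 2C, lambda = C turns the
    rest into the claimed bound ([theta_decay]).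

    That [E B = 0] requires the 4k+2-nd moment of a combination
    [sum_i c_i X_i] of the independent normal coordinates of the increment to
    be that of one normal variable of the same variance.  Instead of computing
    moments or the law of the sum, one compares moment generating functions:
    independence factors [E exp(l sum_i c_i X_i)] into one-dimensional
    integrals ([mgf_lincomb_independent]), and the moments are recovered from
    [l |-> E exp(l Y)] through [E Y^n = lim_N E (N (exp(Y/N) - 1))^n], whose
    terms each involve only finitely many values of the generating function
    ([mgf_moment_cvg]).  The finite exponential moments also make A and B
    integrable. *)

(** * Integrals against a weight *)

Section Transfer.
Context (d1 d2 : measure_display) (T1 : measurableType d1)
  (T2 : measurableType d2) (R : realType).
Local Open Scope ereal_scope.
Import HBNNSimple.

(** A common form of three facts used below: integration against a density
    (take X the identity), change of variables to the law of X (take w = 1),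
    and splitting off an independent factor w, when the weighted law of X is a
    multiple of its law.  Both sides are linear and continuous along increasing
    sequences of simple functions, so it is enough to compare them on
    indicators. *)
Lemma ge0_integral_weighted (mu1 : {measure set T1 -> \bar R})
    (mu2 : {measure set T2 -> \bar R}) (X : T1 -> T2) (w : T1 -> R) :
  measurable_fun setT X -> measurable_fun setT w -> (forall x, 0 <= w x)%R ->
  (forall B, measurable B -> \int[mu1]_(x in X @^-1` B) (w x)%:E = mu2 B) ->
  forall f : T2 -> \bar R, measurable_fun setT f -> (forall y, 0 <= f y) ->
  \int[mu1]_x (f (X x) * (w x)%:E) = \int[mu2]_y f y.
Proof.
move=> mX mw w0 mu12 f mf f0.
have mew : measurable_fun setT (EFin \o w) by exact/measurable_EFinP.
pose g := nnsfun_approx measurableT mf.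
have cvg_g y : (g n y)%:E @[n --> \oo] --> f y.
  exact: (cvg_nnsfun_approx measurableT mf (fun y _ => f0 y) (x := y)).
have ndg y : {homo (fun n => g n y) : a b / (a <= b)%N >-> (a <= b)%R}.
  by move=> a b ab; exact/lefP/nd_nnsfun_approx.
have mgX n : measurable_fun setT (fun x => g n (X x)).
  exact: (measurableT_comp (measurable_funP (g n)) mX).
have -> : \int[mu2]_y f y = lim (\int[mu2]_y (g n y)%:E @[n --> \oo]).
  under eq_integral => y _ do rewrite -(cvg_lim (@ereal_hausdorff R) (cvg_g y)).
  apply: monotone_convergence => //.
  - by move=> n; exact/measurable_EFinP.
  - by move=> n y _; rewrite lee_fin.
  - by move=> y _ a b ab; rewrite lee_fin ndg.
have -> : \int[mu1]_x (f (X x) * (w x)%:E) =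
    lim (\int[mu1]_x ((g n (X x))%:E * (w x)%:E) @[n --> \oo]).
  have cvg_gw x : (g n (X x))%:E * (w x)%:E @[n --> \oo] -->
      f (X x) * (w x)%:E by exact: cvgeZr.
  under eq_integral => x _ do rewrite -(cvg_lim (@ereal_hausdorff R) (cvg_gw x)).
  apply: monotone_convergence => //.
  - by move=> n; apply: emeasurable_funM => //; exact/measurable_EFinP.
  - by move=> n x _; rewrite mule_ge0 ?lee_fin.
  - by move=> x _ a b ab; rewrite lee_wpmul2r ?lee_fin ?ndg.
suff gE n : \int[mu1]_x ((g n (X x))%:E * (w x)%:E) = \int[mu2]_y (g n y)%:E.
  by under eq_fun do rewrite gE.
rewrite integralT_nnsfun sintegralE.
under eq_integral => x _.
  rewrite (fimfunE (g n) (X x)) -fsumEFin// ge0_mule_fsuml; last first.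
    by move=> r; exact: nnfun_muleindic_ge0.
  over.
have mind r : measurable_fun setT
    (fun x => \1_(g n @^-1` [set r]) (X x) : R).
  apply: (measurableT_comp (measurable_indic _) mX).
  exact: measurable_funPTI.
rewrite ge0_integral_fsum//; last 2 first.
  - move=> r; apply: emeasurable_funM => //; apply/measurable_EFinP.
    exact: measurable_funM.
  - by move=> r x _; rewrite mule_ge0 ?nnfun_muleindic_ge0 ?lee_fin.
apply: eq_fsbigr => r; rewrite inE => -[y _ <-].
under eq_integral => x _ do rewrite EFinM -muleA.
rewrite ge0_integralZl//; last 3 first.
  - by apply: emeasurable_funM => //; exact/measurable_EFinP.
  - by move=> x _; rewrite mule_ge0 ?lee_fin.
  - by rewrite lee_fin.
congr (_ * _); rewrite -mu12; last exact: measurable_funPTI.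
rewrite [RHS]integral_mkcond; apply: eq_integral => x _.
rewrite patchE indicE.
have -> : (X x \in g n @^-1` [set g n y]) =
    (x \in X @^-1` (g n @^-1` [set g n y])) by apply/idP/idP; rewrite !inE.
by case: ifPn => _; rewrite ?mul1e ?mul0e.
Qed.
End Transfer.

(** * Products of independent variables *)

Section Independence.
Context (disp : measure_display) (Om : measurableType disp) (R : realType)
  (P : probability Om R) (I : finType) (X : I -> Om -> R).
Hypothesis mX : forall i, measurable_fun setT (X i).
Local Open Scope ereal_scope.

Lemma prod_indic_preimage (B : I -> set R) om :
  (\prod_i \1_(B i) (X i om))%R = \1_(\bigcap_i (X i @^-1` B i)) om :> R.
Proof.
rewrite [RHS]indicE; have [omB|omB] := boolP (om \in _).
  rewrite big1// => i _; rewrite indicE mem_set//.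
  by move: omB; rewrite inE => /(_ i); exact.
have [i omBi] : exists i, ~ B i (X i om).
  apply/existsNP => omB'; move/negP : omB; apply; rewrite inE => i _.
  exact: omB'.
by rewrite (bigD1 i)//= indicE memNset// mul0r.
Qed.

(** The definition of independence is the case where every g i is an
    indicator.  The indicators are replaced one index at a time by the general
    functions: for all but the l-th factor fixed, the induction hypothesis says
    that the law of X l weighted by the other factors is a multiple of the law
    of X l. *)
Lemma ge0_integral_prod_independent (g : I -> R -> R) (c : I -> R) :
  mutually_independent P X ->
  (forall i, measurable_fun setT (g i)) -> (forall i y, 0 <= g i y)%R ->
  (forall i, \int[P]_om (g i (X i om))%:E = (c i)%:E) ->
  \int[P]_om (\prod_i g i (X i om))%:E = (\prod_i c i)%:E.
Proof.
move=> indep mg g0 gc.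
have c0 i : (0 <= c i)%R.
  by rewrite -lee_fin -gc; apply: integral_ge0 => om _; rewrite lee_fin.
pose h (s : seq I) (B : I -> set R) i := if i \in s then g i else \1_(B i).
pose e (s : seq I) (B : I -> set R) i :=
  if i \in s then c i else fine (P (X i @^-1` B i)).
have mXB i B : measurable B -> measurable (X i @^-1` B).
  by move=> mB; rewrite -[X in measurable X]setTI; exact: mX.
(* The list s holds the indices where g has already replaced an indicator. *)
suff main (s : seq I) B : (forall i, measurable (B i)) ->
    \int[P]_om (\prod_i h s B i (X i om))%:E = (\prod_i e s B i)%:E.
  have := main (enum I) (fun=> setT) (fun=> measurableT).
  under eq_integral do under eq_bigr do rewrite /h mem_enum inE.
  by move=> ->; congr EFin; apply: eq_bigr => i _; rewrite /e mem_enum inE.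
elim: s B => [|l s IHs] B mB.
  under eq_integral => om _ do rewrite prod_indic_preimage.
  have mcap : measurable (\bigcap_i (X i @^-1` B i)).
    by apply: fin_bigcap_measurable => // i _; exact: mXB.
  rewrite integral_indic// setIT. transitivity (\prod_i P (X i @^-1` B i)).
    exact: indep.
  rewrite -prodEFin.
  by apply: eq_bigr => i _; rewrite fineK// fin_num_measure//; exact: mXB.
have [ls|ls] := boolP (l \in s).
  rewrite -(_ : h s B = h (l :: s) B); last first.
    by apply/funext => i; rewrite /h inE; case: eqVneq => // ->; rewrite ls.
  rewrite IHs//; congr EFin; apply: eq_bigr => i _.
  by rewrite /e inE; case: eqVneq => // ->; rewrite ls.
have mh i : measurable_fun setT (h s B i).
  by rewrite /h; case: ifP => // _; exact: measurable_indic.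
have h0 i y : (0 <= h s B i y)%R by rewrite /h; case: ifP.
have e0 i : (0 <= e s B i)%R by rewrite /e; case: ifP => // _; exact: fine_ge0.
pose w om := (\prod_(i | i != l) h s B i (X i om))%R.
have w0 om : (0 <= w om)%R by exact: prodr_ge0.
have mw : measurable_fun setT w.
  rewrite /w; under eq_fun => om do rewrite -big_filter.
  apply: measurable_prod => i _.
  exact: (measurableT_comp (mh i) (mX i)).
have C0 : (0 <= \prod_(i | i != l) e s B i)%R by exact: prodr_ge0.
pose Xl : {mfun Om >-> R} :=
  HB.pack (X l) (isMeasurableFun.Build _ _ _ _ _ (mX l)).
pose mu2 : {measure set R -> \bar R} := mscale (NngNum C0) (distribution P Xl).
have gw : \int[P]_om (((EFin \o g l) (X l om)) * (w om)%:E) =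
    \int[mu2]_y (EFin \o g l) y.
  apply: ge0_integral_weighted => //; last 2 first.
  - exact/measurable_EFinP.
  - by move=> y /=; rewrite lee_fin.
  move=> B' mB'.
  pose B1 i := if i == l then B' else B i.
  have mB1 i : measurable (B1 i) by rewrite /B1; case: ifP.
  transitivity (\int[P]_om (\prod_i h s B1 i (X i om))%:E).
    rewrite integral_mkcond; apply: eq_integral => om _.
    rewrite patchE (bigD1 l)//= {1}/h (negPf ls) /B1 eqxx indicE.
    have -> : (X l om \in B') = (om \in X l @^-1` B').
      by apply/idP/idP; rewrite !inE.
    case: ifPn => _; rewrite ?mul0r// mul1r; congr EFin; apply: eq_bigr => i il.
    by rewrite /h (negPf il).
  rewrite IHs// (bigD1 l)//= mulrC EFinM; congr (_ * _).
    by congr EFin; apply: eq_bigr => i il; rewrite /e /B1 (negPf il).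
  rewrite /e (negPf ls) /B1 eqxx fineK// fin_num_measure//; exact: mXB.
transitivity (\int[P]_om (((EFin \o g l) (X l om)) * (w om)%:E)).
  apply: eq_integral => om _; rewrite (bigD1 l)//= {1}/h mem_head EFinM.
  congr (_ * _); congr EFin; apply: eq_bigr => i il.
  by rewrite /h inE (negPf il).
rewrite gw ge0_integral_mscale//; last 2 first.
- exact/measurable_EFinP.
- by move=> y _ /=; rewrite lee_fin.
rewrite ge0_integral_distribution//=; last 2 first.
- exact/measurable_EFinP.
- by move=> y /=; rewrite lee_fin.
rewrite gc [in RHS](bigD1 l)//= (_ : e (l :: s) B l = c l); last first.
  by rewrite /e mem_head.
rewrite mulrC EFinM; congr (_ * _); congr EFin; apply: eq_bigr => i il.
by rewrite /e inE (negPf il).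
Qed.

End Independence.

(** * Moments and the moment generating function *)

Section ExpBounds.
Context (R : realType).
Implicit Types (x y z : R) (n : nat).

Lemma expR_norm_le x : expR `|x| <= expR x + expR (- x).
Proof.
have [x0|x0] := leP 0 x; first by rewrite ger0_norm// lerDl expR_ge0.
by rewrite ltr0_norm// lerDr expR_ge0.
Qed.

Lemma norm_le_expR x : `|x| <= expR `|x|.
Proof. by apply: le_trans (expR_ge1Dx _); rewrite lerDr. Qed.

Lemma normX_le_expR n x : `|x| ^+ n <= expR (n%:R * x) + expR (- n%:R * x).
Proof.
apply: (@le_trans _ _ (expR `|n%:R * x|)); last first.
  by rewrite mulNr expR_norm_le.
rewrite normrM ger0_norm// expRM_natl.
by apply: lerXn2r; rewrite ?nnegrE ?expR_ge0 ?norm_le_expR.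
Qed.

Lemma expR_sub1_le z : expR z - 1 <= z * expR z.
Proof.
have := expR_ge1Dx (- z).
rewrite -(ler_pM2r (expR_gt0 z)) -expRD addNr expR0.
lra.
Qed.

Lemma expR_sub1_norm_le z : `|expR z - 1| <= `|z| * expR `|z|.
Proof.
have h1 := expR_sub1_le z; have h2 := expR_ge1Dx z.
have [z0|z0] := leP 0 z.
  by rewrite !ger0_norm//; lra.
rewrite ler0_norm; last by rewrite subr_le0 expR_le1 ltW.
rewrite ltr0_norm//; have : 1 <= expR (- z) by have := expR_ge1Dx (- z); lra.
by rewrite -(ler_pM2l (_ : 0 < - z)) ?oppr_gt0// mulr1; lra.
Qed.

(** The difference quotient of [l |-> expR (l * y)] at 0 with step 1/(n+1).
    Its powers are polynomials in exponentials of y, so that their expectations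
    are combinations of values of the moment generating function. *)
Definition diff_quot n y : R := n.+1%:R * (expR (y / n.+1%:R) - 1).

(** The bound does not depend on n: it provides the dominating function for
    the limit under the expectation. *)
Lemma diff_quot_norm_le n y : `|diff_quot n y| <= expR (`|y| *+ 2).
Proof.
rewrite /diff_quot normrM ger0_norm//.
apply: (@le_trans _ _ (n.+1%:R * (`|y / n.+1%:R| * expR `|y / n.+1%:R|))).
  by rewrite ler_wpM2l// expR_sub1_norm_le.
rewrite normrM normfV (ger0_norm (ler0n _ _)).
rewrite [X in X <= _](_ : _ = `|y| * expR (`|y| / n.+1%:R)); last first.
  by rewrite mulrA [n.+1%:R * _]mulrC divfK// pnatr_eq0.
rewrite mulr2n expRD ler_pM ?expR_ge0 ?norm_le_expR//.
by rewrite ler_expR ler_pdivrMr ?ltr0n// ler_peMr// ler1n.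
Qed.

Lemma diff_quot_cvg y : diff_quot n y @[n --> \oo] --> y.
Proof.
have cvg_inv : y / n.+1%:R @[n --> \oo] --> (0 : R).
  rewrite -(mulr0 y); apply: cvgM; first exact: cvg_cst.
  exact: cvg_harmonic.
apply: (@squeeze_cvgr _ _ _ _ (fun=> y) (fun n => y * expR (y / n.+1%:R))).
- apply: nearW => n; rewrite /diff_quot.
  have n0 : 0 < n.+1%:R :> R by rewrite ltr0n.
  have yE : y = n.+1%:R * (y / n.+1%:R) by rewrite mulrC divfK ?gt_eqF.
  rewrite {1}yE {4}yE -mulrA !ler_pM2l// expR_sub1_le andbT.
  by rewrite lerBrDl expR_ge1Dx.
- exact: cvg_cst.
- rewrite [X in _ --> X](_ : y = y * expR 0); last by rewrite expR0 mulr1.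
  apply: cvgM; first exact: cvg_cst.
  by apply: (cvg_comp _ _ cvg_inv); exact: continuous_expR.
Qed.

End ExpBounds.

Section Moments.
Context (disp : measure_display) (Om : measurableType disp) (R : realType)
  (P : probability Om R) (Y : Om -> R) (M : R -> R).
Hypothesis mY : measurable_fun setT Y.
Hypothesis mgfY : forall l, (\int[P]_om (expR (l * Y om))%:E = (M l)%:E)%E.

Lemma integrable_expR_mul l :
  P.-integrable setT (EFin \o (fun om => expR (l * Y om))).
Proof.
apply/integrableP; split.
  apply/measurable_EFinP; apply: measurableT_comp => //;
    exact: measurable_funM.
under eq_integral do rewrite /= ger0_norm ?expR_ge0//.
by rewrite mgfY ltry.
Qed.

Lemma integrable_exprn_mgf n :
  P.-integrable setT (EFin \o (fun om => Y om ^+ n)).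
Proof.
have hI := integrableD measurableT (integrable_expR_mul n%:R)
  (integrable_expR_mul (- n%:R)).
apply: le_integrable hI => //.
  by apply/measurable_EFinP; exact: measurable_funX.
move=> om _ /=; rewrite lee_fin normrX (le_trans (normX_le_expR _ _))//.
by rewrite ger0_norm// addr_ge0 ?expR_ge0.
Qed.

(** By the binomial theorem the power of the difference quotient is a
    combination of exponentials of Y, so that its expectation is an expression
    in M alone. *)
Lemma expectation_diff_quot_exprn N n :
  (\int[P]_om (diff_quot N (Y om) ^+ n)%:E =
   (N.+1%:R ^+ n *
    \sum_(j < n.+1) ((-1) ^+ (n - j) * M (j%:R / N.+1%:R)) *+ 'C(n, j))%:E)%E.
Proof.
pose F j om := expR ((j%:R / N.+1%:R) * Y om) : R.
have dE om : diff_quot N (Y om) ^+ n = N.+1%:R ^+ n *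
    \sum_(j < n.+1) ((-1) ^+ (n - j) *+ 'C(n, j)) * F j om.
  rewrite /diff_quot exprMn addrC exprDn; congr (_ * _).
  apply: eq_bigr => j _; rewrite /F mulrnAl; congr (_ * _ *+ _).
  by rewrite -expRM_natl mulrA mulrAC -mulrA.
under eq_integral do rewrite dE EFinM.
have iF j : P.-integrable setT (EFin \o F j) by exact: integrable_expR_mul.
have mF j : (\int[P]_om (F j om)%:E = (M (j%:R / N.+1%:R))%:E)%E by exact: mgfY.
have iS : P.-integrable setT (EFin \o (fun om =>
    \sum_(j < n.+1) ((-1) ^+ (n - j) *+ 'C(n, j)) * F j om)).
  rewrite (_ : _ \o _ = (fun om => \sum_(j < n.+1)
    (((-1) ^+ (n - j) *+ 'C(n, j))%:E * (F j om)%:E)%E)%E); last first.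
    by apply/funext => om /=; rewrite -sumEFin; apply: eq_bigr.
  by apply: integrable_sum => // j _; exact: (integrableZl measurableT _ (iF j)).
rewrite integralZl//= EFinM; congr (_ * _)%E.
under eq_integral do rewrite -sumEFin.
rewrite integral_sum//; last first.
  move=> j; rewrite (_ : (fun _ => _) = fun om =>
    (((-1) ^+ (n - j) *+ 'C(n, j))%:E * (F j om)%:E)%E)//.
  exact: (integrableZl measurableT _ (iF j)).
rewrite -sumEFin; apply: eq_bigr => j _.
under eq_integral do rewrite EFinM.
rewrite (integralZl measurableT (iF j)).
by rewrite [X in (_ * X)%E]mF -EFinM (mulrnAl ((-1) ^+ (n - j))).
Qed.

(** The difference quotient converges pointwise to Y; its n-th power is
    dominated by [expR (2n |Y|)], which is at most the sum of the two
    integrable exponentials of slopes 2n and -2n. *)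
Lemma mgf_moment_cvg n :
  (N.+1%:R ^+ n *
    \sum_(j < n.+1) ((-1) ^+ (n - j) * M (j%:R / N.+1%:R)) *+ 'C(n, j))%:E
    @[N --> \oo] --> (\int[P]_om (Y om ^+ n)%:E)%E.
Proof.
under eq_fun do rewrite -expectation_diff_quot_exprn.
have hI := integrableD measurableT (integrable_expR_mul (2 * n)%:R)
  (integrable_expR_mul (- (2 * n)%:R)).
have mq N : measurable_fun setT (fun om => (diff_quot N (Y om) ^+ n)%:E).
  apply/measurable_EFinP; apply: measurable_funX; apply: measurable_funM => //.
  apply: measurable_funB => //; apply: measurableT_comp => //.
  exact: measurable_funM.
have [] // := @dominated_convergence _ _ _ P setT measurableT
  (fun N om => (diff_quot N (Y om) ^+ n)%:E) (fun om => (Y om ^+ n)%:E)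
  _ mq _ _ hI.
- by apply/measurable_EFinP; exact: measurable_funX.
- apply/aeW => om _; apply: cvg_EFin; first exact: nearW.
  apply: (@cvg_comp _ _ _ (fun N => diff_quot N (Y om)) (fun x => x ^+ n)).
    exact: diff_quot_cvg.
  exact: exprn_continuous.
- apply/aeW => om N _ /=; rewrite lee_fin normrX.
  apply: (@le_trans _ _ (expR (`|Y om| *+ 2) ^+ n)).
    by apply: lerXn2r; rewrite ?nnegrE ?expR_ge0 ?diff_quot_norm_le.
  rewrite -expRM_natl mulNr; apply: le_trans (expR_norm_le _).
  by rewrite normrM ger0_norm// natrM -[_ *+ 2]mulr_natl mulrA [n%:R * _]mulrC.
Qed.

End Moments.

(** By [mgf_moment_cvg] both moments are limits of one and the same sequence,
    built from M alone. *)
Lemma moments_of_mgf (d1 d2 : measure_display) (O1 : measurableType d1)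
    (O2 : measurableType d2) (R : realType) (Q1 : probability O1 R)
    (Q2 : probability O2 R) (Y1 : O1 -> R) (Y2 : O2 -> R) (M : R -> R) (n : nat) :
  measurable_fun setT Y1 -> measurable_fun setT Y2 ->
  (forall l, (\int[Q1]_om (expR (l * Y1 om))%:E = (M l)%:E)%E) ->
  (forall l, (\int[Q2]_om (expR (l * Y2 om))%:E = (M l)%:E)%E) ->
  (\int[Q1]_om (Y1 om ^+ n)%:E = \int[Q2]_om (Y2 om ^+ n)%:E)%E.
Proof.
move=> mY1 mY2 mgf1 mgf2.
have c1 := mgf_moment_cvg mY1 mgf1 (n := n).
have c2 := mgf_moment_cvg mY2 mgf2 (n := n).
exact: (cvg_unique (@ereal_hausdorff R) c1 c2).
Qed.

(** * Normal laws *)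

Section Gaussian.
Context (R : realType).
Local Open Scope ereal_scope.

Lemma ge0_integral_normal_prob (m s : R) (f : R -> \bar R) :
  measurable_fun setT f -> (forall y, 0 <= f y) ->
  \int[normal_prob m s]_x f x =
  \int[lebesgue_measure]_x (f x * (normal_pdf m s x)%:E).
Proof.
move=> mf f0; apply/esym.
apply: (@ge0_integral_weighted _ _ _ _ _ lebesgue_measure (normal_prob m s)
  idfun (normal_pdf m s)) => //.
- exact: measurable_id.
- exact: measurable_normal_pdf.
- by move=> x; exact: normal_pdf_ge0.
Qed.

(** Completing the square turns [expR (l * x)] times the centered density into
    a constant times the density with mean [l * s ^+ 2], whose integral is 1. *)
Lemma normal_prob_mgf (s l : R) : s != 0%R ->
  \int[normal_prob 0 s]_x (expR (l * x))%:E =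
  (expR (l ^+ 2 * s ^+ 2 / 2))%:E.
Proof.
move=> s0; rewrite ge0_integral_normal_prob; last 2 first.
- apply/measurable_EFinP; apply: measurableT_comp => //;
    exact: measurable_funM.
- by move=> y; rewrite lee_fin expR_ge0.
transitivity (\int[lebesgue_measure]_x
    ((expR (l ^+ 2 * s ^+ 2 / 2))%:E * (normal_pdf (l * s ^+ 2) s x)%:E)).
  apply: eq_integral => x _; rewrite -!EFinM !normal_pdfE//; congr EFin.
  rewrite mulrCA [RHS]mulrCA; congr (_ * _)%R.
  rewrite /normal_fun -!expRD; congr expR; rewrite -mulr_natr.
  by field; exact: s0.
rewrite integralZl//; last exact: integrable_normal_pdf.
by rewrite integral_normal_pdf mule1.
Qed.

Lemma normal_law_mgf (disp : measure_display) (Om : measurableType disp)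
    (P : probability Om R) (X : Om -> R) (s l : R) : s != 0%R ->
  measurable_fun setT X ->
  (forall B, measurable B -> P (X @^-1` B) = normal_prob 0 s B) ->
  \int[P]_om (expR (l * X om))%:E = (expR (l ^+ 2 * s ^+ 2 / 2))%:E.
Proof.
move=> s0 mX lawX; rewrite -normal_prob_mgf//.
rewrite -(@ge0_integral_weighted _ _ Om _ R P (normal_prob 0 s) X (cst 1%R))//.
- by apply: eq_integral => om _; rewrite mule1.
- move=> B mB; transitivity (P (X @^-1` B)); last exact: lawX.
  rewrite -[RHS]mul1e -integral_cst// -[X in measurable X]setTI; exact: mX.
- apply/measurable_EFinP; apply: measurableT_comp => //;
    exact: measurable_funM.
Qed.

Lemma mgf_lincomb_independent (disp : measure_display)
    (Om : measurableType disp) (P : probability Om R) (I : finType)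
    (X : I -> Om -> R) (v : R) (c : I -> R) (l : R) :
  (forall i, measurable_fun setT (X i)) -> mutually_independent P X ->
  (forall i l, \int[P]_om (expR (l * X i om))%:E = (expR (l ^+ 2 * v / 2))%:E) ->
  \int[P]_om (expR (l * \sum_i c i * X i om))%:E =
  (expR (l ^+ 2 * ((\sum_i c i ^+ 2) * v) / 2))%:E.
Proof.
move=> mX indep mgfX.
transitivity (\int[P]_om (\prod_i expR (l * c i * X i om))%:E).
  apply: eq_integral => om _; rewrite -expR_sum mulr_sumr; congr (expR _)%:E.
  by apply: eq_bigr => i _; rewrite mulrA.
rewrite (@ge0_integral_prod_independent _ _ _ _ _ _ mX
  (fun i x => expR (l * c i * x)) (fun i => expR ((l * c i) ^+ 2 * v / 2)))//.
- rewrite -expR_sum mulr_suml mulr_sumr mulr_suml; congr (expR _)%:E.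
  by apply: eq_bigr => i _; rewrite exprMn; ring.
- by move=> i; apply: measurableT_comp => //; exact: measurable_funM.
Qed.

(** A vanishing even moment would force x = 0 almost surely, but the normal law
    has no atom.  Positivity is needed because c_k is a reciprocal. *)
Lemma normal_even_moment_gt0 (n : nat) :
  (0 < fine (\int[normal_prob (0:R) 1]_x (x ^+ (2 * n))%:E))%R.
Proof.
have mgf1 l : \int[normal_prob (0:R) 1]_x (expR (l * x))%:E =
    (expR (l ^+ 2 / 2))%:E.
  by rewrite normal_prob_mgf ?oner_eq0// expr1n mulr1.
have iX : (normal_prob (0:R) 1).-integrable setT
    (EFin \o (fun x : R => x ^+ (2 * n))%R).
  by have := @integrable_exprn_mgf _ _ R (normal_prob 0 1) idfun _
    (@measurable_id _ _ _) mgf1 (2 * n).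
have mX : measurable_fun [set: R] (EFin \o (fun x : R => x ^+ (2 * n))%R).
  exact: measurable_int iX.
have X0 (x : R) : 0 <= (x ^+ (2 * n))%R%:E.
  by rewrite lee_fin exprM exprn_ge0// sqr_ge0.
rewrite fine_gt0//; apply/andP; split; last first.
  by rewrite ltey_eq integrable_fin_num.
rewrite lt_neqAle integral_ge0// andbT eq_sym; apply/negP => /eqP E0.
have : ae_eq (normal_prob (0:R) 1) setT
    (EFin \o (fun x : R => x ^+ (2 * n))%R) (cst 0).
  apply/ae_eq_integral_abs => //.
  by rewrite -[RHS]E0; apply: eq_integral => x _; rewrite gee0_abs//=.
move=> [N [mN N0 subN]].
have : normal_prob (0:R) 1 setT <= 0.
  apply: (@le_trans _ _ (normal_prob (0:R) 1 (N `|` [set 0%R]))).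
    apply: le_measure; rewrite ?inE//; first exact: measurableU.
    move=> x _; have [->|x0] := eqVneq x 0%R; [by right|left].
    apply: subN => /= /(_ Logic.I) [] /eqP; rewrite expf_eq0 (negPf x0) andbF.
    by [].
  rewrite (le_trans (measureU2 _ _ _))//.
  rewrite [X in X + _]N0 add0e.
  have /null_content_dominatesP dom := @normal_prob_dominates R 0 1.
  have dom0 : normal_prob (0:R) 1 [set 0%R] = 0.
    by apply: dom => //; exact: lebesgue_measure_set1.
  by rewrite [leLHS]dom0.
by rewrite probability_setT lee_fin ler10.
Qed.

End Gaussian.

(** * Continuous functions of random vectors *)

Section ContinuousOfRandomVector.
Context (disp : measure_display) (Om : measurableType disp) (R : realType)
  (d : nat) (Z : Om -> 'cV[R]_d).
Hypothesis mZ : forall i, measurable_fun setT (fun om => Z om i 0).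

(** An open set is the union of the boxes with rational endpoints that it
    contains, hence a countable union of finite intersections of conditions on
    single coordinates. *)
Lemma measurable_preimage_open_cV (A : set 'cV[R]_d) :
  open A -> measurable (Z @^-1` A).
Proof.
move=> oA.
pose box (q : 'cV[rat]_d * 'cV[rat]_d) : set 'cV[R]_d :=
  [set v | forall i, v i 0 \in `]ratr (q.1 i 0), ratr (q.2 i 0)[].
pose F n : set Om := if unpickle n is Some q then
  if `[< box q `<=` A >] then Z @^-1` box q else set0 else set0.
have -> : Z @^-1` A = \bigcup_n F n.
  apply/seteqP; split => [om Aom|om [n _]]; last first.
    rewrite /F; case: unpickle => [q|]//.
    by case: asboolP => // qA /qA.
  have /nbhs_ballP [e /= e0 eA] := open_nbhs_nbhs (conj oA Aom).
  have /choice [q1 q1P] i : exists q : rat, ratr q \in `]Z om i 0 - e, Z om i 0[.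
    by apply: rat_in_itvoo; rewrite ltrBlDr ltrDl.
  have /choice [q2 q2P] i : exists q : rat, ratr q \in `]Z om i 0, Z om i 0 + e[.
    by apply: rat_in_itvoo; rewrite ltrDl.
  exists (pickle (\col_i q1 i, \col_i q2 i)) => //.
  rewrite /F pickleK; case: asboolP => [_ i /=|].
    move: (q1P i) (q2P i); rewrite !mxE !in_itv /=.
    by move=> /andP[_ ->] /andP[->].
  case=> v bv; apply: eA; split=> // i j; rewrite (ord1 j).
  move: (bv i) (q1P i) (q2P i); rewrite !mxE !in_itv /= /ball /= ltr_distlC.
  move=> /andP[v1 v2] /andP[q11 q12] /andP[q21 q22].
  by rewrite (lt_trans q11 v1) (lt_trans v2 q22).
apply: bigcupT_measurable => n; rewrite /F.
case: unpickle => [q|]//; case: asboolP => // _.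
rewrite [X in measurable X](_ : _ = \bigcap_i
    ((fun om => Z om i 0) @^-1` `]ratr (q.1 i 0), ratr (q.2 i 0)[)); last first.
  by apply/seteqP; split=> om h i; [move=> _; exact: h|exact: (h i Logic.I)].
apply: fin_bigcap_measurable => // i _.
by rewrite -[X in measurable X]setTI; exact: mZ.
Qed.

Lemma measurable_continuous_cV (phi : 'cV[R]_d -> R) :
  continuous phi -> measurable_fun setT (phi \o Z).
Proof.
move=> /continuousP cphi; apply: (measurability _ (RGenOpens.measurableE R)).
move=> _ [_ [a [b ->] <-]]; rewrite setTI comp_preimage.
apply: measurable_preimage_open_cV; apply: cphi; exact: interval_open.
Qed.

End ContinuousOfRandomVector.

(** * Integrable real variables *)

Lemma fine_expectationE (disp : measure_display) (Om : measurableType disp)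
    (R : realType) (P : probability Om R) (X : Om -> R) :
  fine 'E_P[X] = \int[P]_om X om.
Proof. by rewrite unlock. Qed.

Section RealIntegrable.
Context (disp : measure_display) (Om : measurableType disp) (R : realType)
  (P : probability Om R).
Implicit Types f g : Om -> R.
Local Notation intP f := (P.-integrable setT (EFin \o f)).

Lemma integrable_EFinD f g : intP f -> intP g -> intP (fun om => f om + g om).
Proof. by move=> If Ig; have := integrableD measurableT If Ig. Qed.

Lemma integrable_EFinB f g : intP f -> intP g -> intP (fun om => f om - g om).
Proof. by move=> If Ig; have := integrableB measurableT If Ig. Qed.

Lemma integrable_EFinZl (a : R) f : intP f -> intP (fun om => a * f om).
Proof. by move=> If; have := integrableZl measurableT a If. Qed.

Lemma integrable_EFin_cst (a : R) : intP (fun=> a).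
Proof. exact: finite_measure_integrable_cst. Qed.

Lemma integrable_EFin_sum (I : Type) (s : seq I) (f : I -> Om -> R) :
  (forall i, intP (f i)) -> intP (fun om => \sum_(i <- s) f i om).
Proof.
move=> If; rewrite (_ : _ \o _ = fun om => (\sum_(i <- s) (f i om)%:E)%E).
  by apply: integrable_sum => // i _; exact: If.
by apply/funext => om /=; rewrite sumEFin.
Qed.

Lemma integrable_bounded (Z : Om -> R) (C : R) :
  measurable_fun setT Z -> (forall om, `|Z om| <= C) -> intP Z.
Proof.
move=> mZ ZC; apply: measurable_bounded_integrable => //.
  by rewrite -ge0_fin_numE ?fin_num_measure.
exists C; split; first exact: num_real.
by move=> y Cy om _ /=; exact: le_trans (ZC om) (ltW Cy).
Qed.

Lemma integrable_boundedM (Z f : Om -> R) (C : R) :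
  measurable_fun setT Z -> (forall om, `|Z om| <= C) -> intP f ->
  intP (fun om => Z om * f om).
Proof.
move=> mZ ZC If; apply: (integrableMr measurableT mZ _ If).
  exists C; split; first exact: num_real.
  by move=> y Cy om _ /=; exact: le_trans (ZC om) (ltW Cy).
Qed.

End RealIntegrable.

(** * The weights P1 and P2 *)

Section Weights.
Context (R : realType) (d : nat).
Implicit Types (g w : 'cV[R]_d).

Lemma P1_ge0 g w : 0 <= P1 g w.
Proof.
have pos_ge0 (v : 'cV[R]_d) i : 0 <= pos_part v i 0.
  by rewrite mxE le_max lexx orbT.
have neg_ge0 (v : 'cV[R]_d) i : 0 <= neg_part v i 0.
  by rewrite mxE oppr_ge0 ge_min lexx orbT.
by rewrite mulr_ge0// addr_ge0//; apply: sumr_ge0 => i _; rewrite mulr_ge0.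
Qed.

Lemma norm2_sqr (v : 'cV[R]_d) : norm2 v ^+ 2 = \sum_i v i 0 ^+ 2.
Proof.
rewrite /norm2 sqr_sqrtr; last by apply: sumr_ge0 => i _; rewrite -expr2 sqr_ge0.
by apply: eq_bigr => i _; rewrite expr2.
Qed.

Lemma mxtrace_mul_tr q (S : 'M[R]_(d, q)) :
  \tr (S *m S^T) = \sum_j norm2 (col j S) ^+ 2.
Proof.
under [RHS]eq_bigr do rewrite norm2_sqr.
rewrite exchange_big /=; apply: eq_bigr => i _; rewrite mxE.
by apply: eq_bigr => j _; rewrite !mxE expr2.
Qed.

Lemma exponent_even k : (4 * k + 2 = 2 * (2 * k + 1))%N.
Proof. by rewrite mulnDr mulnA. Qed.

Lemma normal_moment_gt0 k : 0 <
  fine 'E_(normal_prob (0 : R) 1)[fun x => x ^+ (4 * k + 2)].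
Proof.
by rewrite exponent_even fine_expectationE; exact: normal_even_moment_gt0.
Qed.

Lemma coef_c_ge0 k : 0 <= coef_c R k.
Proof. by rewrite invr_ge0 mulr_ge0// ltW// normal_moment_gt0. Qed.

(** The normalization behind [expectation_P2]: for a standard normal N the
    variable [c_k N^(4k+2) - d_k] is centered. *)
Lemma coef_c_moment k :
  coef_c R k * fine 'E_(normal_prob (0 : R) 1)[fun x => x ^+ (4 * k + 2)] =
  coef_d R k.
Proof.
by rewrite /coef_c invfM -mulrA mulVf ?mulr1// gt_eqF// normal_moment_gt0.
Qed.

(** Dropping the even powers only leaves the constants d_k, weighted by the
    squared column norms, which add up to the trace. *)
Lemma P2_ge q k (S : 'M[R]_(d, q)) w :
  - (\tr (S *m S^T) * coef_d R k) <= P2 k S w.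
Proof.
rewrite mxtrace_mul_tr mulr_suml -sumrN; apply: ler_sum => j _ /=.
case: ifPn => [/eqP ->|_]; first by rewrite expr0n mul0r oppr0.
rewrite -mulrN ler_wpM2l ?sqr_ge0// lerDr mulr_ge0 ?coef_c_ge0//.
by rewrite exponent_even exprM exprn_ge0// sqr_ge0.
Qed.

Lemma P2_geN1 q k (S : 'M[R]_(d, q)) w :
  \tr (S *m S^T) <= (4 * k + 2)%:R -> -1 <= P2 k S w.
Proof.
move=> trS; apply: le_trans (P2_ge _ _ _); rewrite lerN2.
by rewrite /coef_d ler_pdivrMr ?mul1r// ltr0n addn2.
Qed.

Context (disp : measure_display) (Om : measurableType disp)
  (P : probability Om R) (X : Om -> 'cV[R]_d) (h : R).
Hypothesis h0 : 0 < h.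
Hypothesis mX : forall i, measurable_fun setT (fun om => X om i 0).
Hypothesis indepX : mutually_independent P (fun i om => X om i 0).
Hypothesis lawX : forall i B, measurable B ->
  P ((fun om => X om i 0) @^-1` B) = normal_prob 0 (Num.sqrt h) B.
Local Notation intP f := (P.-integrable setT (EFin \o f)).

Lemma sqrt_step_neq0 : Num.sqrt h != 0.
Proof. by rewrite gt_eqF ?sqrtr_gt0. Qed.

Lemma coord_mgf i l :
  (\int[P]_om (expR (l * X om i 0))%:E = (expR (l ^+ 2 * h / 2))%:E)%E.
Proof.
rewrite (normal_law_mgf l sqrt_step_neq0 (mX i) (lawX i)).
by rewrite sqr_sqrtr// ltW.
Qed.

Lemma integrable_coord i : intP (fun om => X om i 0).
Proof. exact: (integrable_exprn_mgf (mX i) (coord_mgf i) 1). Qed.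

Lemma integrable_P1 g : intP (fun om => P1 g (h^-1 *: X om)).
Proof.
have intw i : intP (fun om => (h^-1 *: X om) i 0).
  rewrite (_ : (fun om => _) = fun om => h^-1 * X om i 0); last first.
    by apply/funext => om; rewrite mxE.
  exact/integrable_EFinZl/integrable_coord.
have dom (f : R -> R) i : measurable_fun setT f -> (forall x, `|f x| <= `|x|) ->
    intP (fun om => f ((h^-1 *: X om) i 0)).
  move=> mf f_le; apply: le_integrable (intw i) => //.
    apply/measurable_EFinP; apply: measurableT_comp => //.
    by apply/measurable_EFinP; exact: measurable_int (intw i).
  by move=> om _ /=; rewrite lee_fin.
apply: integrable_EFinZl; apply: integrable_EFinD;
  apply: integrable_EFin_sum => i; apply: integrable_EFinZl.
- rewrite (_ : (fun om => _) =
      fun om => Num.max ((h^-1 *: X om) i 0) 0); last first.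
    by apply/funext => om; rewrite mxE.
  apply: (dom (fun x => Num.max x 0)); first exact: measurable_maxr.
  by move=> x; case: (ltP x 0) => // _; rewrite normr0.
- rewrite (_ : (fun om => _) =
      fun om => - Num.min ((h^-1 *: X om) i 0) 0); last first.
    by apply/funext => om; rewrite mxE.
  apply: (dom (fun x => - Num.min x 0)).
    by apply: measurable_funN; exact: measurable_minr.
  by move=> x; case: (ltP x 0) => _; rewrite normrN ?normr0.
Qed.

Section Column.
Context (q : nat) (S : 'M[R]_(d, q)) (j : 'I_q).
Hypothesis Sj : norm2 (col j S) != 0.

Let Y om := (S^T *m ((Num.sqrt h)^-1 *: X om)) j 0 / norm2 (col j S).

Let c i := S i j / (Num.sqrt h * norm2 (col j S)).

Let YE om : Y om = \sum_i c i * X om i 0.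
Proof.
rewrite /Y mxE mulr_suml; apply: eq_bigr => i _; rewrite !mxE /c.
by field; rewrite Sj sqrt_step_neq0.
Qed.

Let sum_c : (\sum_i c i ^+ 2) * h = 1.
Proof.
have nE : norm2 (col j S) ^+ 2 = \sum_i S i j ^+ 2.
  by rewrite norm2_sqr; apply: eq_bigr => i _; rewrite mxE.
under eq_bigr do rewrite /c expr_div_n.
rewrite -mulr_suml -nE exprMn (sqr_sqrtr (ltW h0)).
by field; rewrite Sj gt_eqF.
Qed.

(** The argument of the power in P2 is a linear combination of the increment
    with coefficients whose squares add up to 1/h, so it has the generating
    function of a standard normal variable. *)
Lemma standardized_mgf l :
  (\int[P]_om (expR (l * Y om))%:E = (expR (l ^+ 2 / 2))%:E)%E.
Proof.
under eq_integral do rewrite YE.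
rewrite (@mgf_lincomb_independent _ _ _ _ _ _ h)//; last exact: coord_mgf.
by rewrite sum_c mulr1.
Qed.

Lemma measurable_standardized : measurable_fun setT Y.
Proof.
rewrite (funext YE).
by apply: measurable_sum => i; exact: measurable_funM.
Qed.

(** Equality of generating functions suffices here; the law of the combination
    is never identified. *)
Lemma standardized_moment n :
  \int[P]_om (Y om ^+ n) = fine 'E_(normal_prob (0 : R) 1)[fun x => x ^+ n].
Proof.
rewrite fine_expectationE; congr fine.
apply: (@moments_of_mgf _ _ _ _ _ P (normal_prob 0 1) Y idfun _ n
  measurable_standardized (@measurable_id _ _ _) standardized_mgf).
by move=> l; rewrite normal_prob_mgf ?oner_eq0// expr1n mulr1.
Qed.

Lemma integrable_standardizedX n : intP (fun om => Y om ^+ n).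
Proof. exact: integrable_exprn_mgf measurable_standardized standardized_mgf n. Qed.

End Column.

Section P2.
Context (q k : nat) (S : 'M[R]_(d, q)).

Let term j om :=
  let nj := norm2 (col j S) in
  if nj == 0 then 0
  else nj ^+ 2 * (coef_c R k *
    ((S^T *m ((Num.sqrt h)^-1 *: X om)) j 0 / nj) ^+ (4 * k + 2) - coef_d R k).

Let int_term j : intP (term j).
Proof.
have [Sj|Sj] := eqVneq (norm2 (col j S)) 0; rewrite /term /=.
  by rewrite Sj eqxx; exact: integrable_EFin_cst.
rewrite (negPf Sj).
apply: integrable_EFinZl; apply: integrable_EFinB.
  apply: integrable_EFinZl; exact: integrable_standardizedX.
exact: integrable_EFin_cst.
Qed.

Lemma integrable_P2 : intP (fun om => P2 k S ((Num.sqrt h)^-1 *: X om)).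
Proof. exact: integrable_EFin_sum. Qed.

Let expectation_term j : \int[P]_om term j om = 0.
Proof.
have [Sj|Sj] := eqVneq (norm2 (col j S)) 0; rewrite /term /=.
  by rewrite Sj eqxx Rintegral_cst// mul0r.
rewrite (negPf Sj).
have iY := integrable_EFinZl (coef_c R k) (integrable_standardizedX Sj (4 * k + 2)).
have iB := integrable_EFinB iY (integrable_EFin_cst P (coef_d R k)).
rewrite RintegralZl// RintegralB//; last exact: integrable_EFin_cst.
rewrite RintegralZl//; last exact: integrable_standardizedX.
rewrite standardized_moment// coef_c_moment Rintegral_cst//.
by rewrite [X in fine X]probability_setT mulr1 subrr mulr0.
Qed.

(** Adding a constant to the test function leaves D2 unchanged.  Without this,
    the factor 1/h in D2 would make such a shift unbounded as h tends to 0. *)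
Lemma expectation_P2 : \int[P]_om P2 k S ((Num.sqrt h)^-1 *: X om) = 0.
Proof.
rewrite /Rintegral /P2; under eq_integral do rewrite -sumEFin.
rewrite (integral_sum measurableT (f := fun j om => (term j om)%:E) int_term).
rewrite big1// => j _; rewrite -[LHS]fineK.
  by congr EFin; exact: expectation_term.
exact: (integrable_fin_num measurableT (int_term j)).
Qed.

End P2.
End Weights.

(** * Comparison of maxima *)

Lemma max_ofP (R : realType) (A : set R) :
  has_max A -> A (max_of A) /\ ubound A (max_of A).
Proof.
move=> [y Ay uy]; rewrite /max_of.
by have := @xgetPex R (0 : R) (A `&` ubound A); apply; exists y.
Qed.

Lemma max_of_le (R : realType) (A B : set R) (c : R) :
  has_max A -> has_max B ->
  (forall y, A y -> exists2 z, B z & y <= z + c) ->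
  max_of A <= max_of B + c.
Proof.
move=> /max_ofP[Am _] /max_ofP[_ Bm] AB; have [z Bz Az] := AB _ Am.
by apply: le_trans Az _; rewrite lerD2r; exact: Bm.
Qed.

(** * Brownian increments *)

Section Increment.
Context (R : realType) (disp : measure_display) (Om : measurableType disp)
  (P : probability Om R) (d : nat) (W : R -> Om -> 'cV[R]_d).
Hypothesis bm : brownian_motion P W.
Context (t h : R).
Hypotheses (t0 : 0 <= t) (h0 : 0 < h).

Let incrE i : (fun om => incr W t h om i 0) =
  (fun om => W (t + h) om i 0 - W t om i 0).
Proof. by apply/funext => om; rewrite !mxE. Qed.

Lemma measurable_incr i : measurable_fun setT (fun om => incr W t h om i 0).
Proof.
have [mW _ _ _ _] := bm.
by rewrite incrE; apply: measurable_funB; apply: mW => //; rewrite addr_ge0// ltW.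
Qed.

Lemma incr_law i B : measurable B ->
  P ((fun om => incr W t h om i 0) @^-1` B) = normal_prob 0 (Num.sqrt h) B.
Proof.
have [_ _ _ _ lawW] := bm.
move=> mB; have th : t < t + h by rewrite ltrDl.
have hE : t + h - t = h by rewrite addrAC subrr add0r.
by have := lawW _ _ i _ t0 th mB; rewrite hE incrE.
Qed.

Lemma incr_independent :
  mutually_independent P (fun i om => incr W t h om i 0).
Proof.
move=> B mB; have [_ _ _ indepW _] := bm.
(* A single time step, from t to t + h. *)
pose s j := if j is 0%N then t else t + h.
have s_mono j : s j <= s j.+1 by case: j => [|j]//=; rewrite lerDl ltW.
have := indepW 1%N s t0 s_mono (fun ji => B ji.2) (fun ji => mB ji.2).
rewrite -(pair_bigA _ (fun (j : 'I_1) (i : 'I_d) =>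
  P ((fun om => W (s j.+1) om i 0 - W (s j) om i 0) @^-1` B i)))/=.
rewrite big_ord1 => E; under eq_bigr do rewrite incrE.
rewrite -E; congr (P _); apply/seteqP; split=> om.
  move=> omB [j i] _; have := omB i Logic.I.
  by rewrite /= !mxE (ord1 j).
by move=> omB i _; have := omB (ord0, i) Logic.I; rewrite /= !mxE.
Qed.

End Increment.

(** * Monotonicity of weighted expectations *)

Section WeightedExpectation.
Context (disp : measure_display) (Om : measurableType disp) (R : realType)
  (P : probability Om R) (A B : Om -> R) (h : R).
Local Notation intP f := (P.-integrable setT (EFin \o f)).
Hypotheses (h0 : 0 < h) (iA : intP A) (iB : intP B).
Hypotheses (A0 : forall om, 0 <= A om) (B1 : forall om, -1 <= B om).

Lemma expectation_weight (Z : Om -> R) (C : R) :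
  measurable_fun setT Z -> (forall om, `|Z om| <= C) ->
  \int[P]_om (Z om * (1 + h * A om + B om)) =
  \int[P]_om Z om + h * \int[P]_om (Z om * A om) + \int[P]_om (Z om * B om).
Proof.
move=> mZ ZC.
have iZ := integrable_bounded P mZ ZC.
have iZA := integrable_boundedM mZ ZC iA.
have iZB := integrable_boundedM mZ ZC iB.
under eq_Rintegral do rewrite 2!mulrDr mulr1 mulrCA.
have iZhA := integrable_EFinZl h iZA.
have iZ1 := integrable_EFinD iZ iZhA.
by rewrite RintegralD// RintegralD// RintegralZl.
Qed.

(** The core of both parts: the weight [1 + h A + B] is nonnegative. *)
Lemma expectation_weight_le (Z Z' : Om -> R) (C C' : R) :
  measurable_fun setT Z -> (forall om, `|Z om| <= C) ->
  measurable_fun setT Z' -> (forall om, `|Z' om| <= C') ->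
  (forall om, Z om <= Z' om) ->
  \int[P]_om Z om + h * \int[P]_om (Z om * A om) + \int[P]_om (Z om * B om) <=
  \int[P]_om Z' om + h * \int[P]_om (Z' om * A om) + \int[P]_om (Z' om * B om).
Proof.
move=> mZ ZC mZ' ZC' ZZ'.
rewrite -(expectation_weight mZ ZC) -(expectation_weight mZ' ZC').
have iW : intP (fun om => 1 + h * A om + B om).
  apply: integrable_EFinD => //; apply: integrable_EFinD.
    exact: integrable_EFin_cst.
  exact: integrable_EFinZl.
apply: le_Rintegral => //; [exact: integrable_boundedM ZC iW|
  exact: integrable_boundedM ZC' iW|].
move=> om _; rewrite ler_wpM2r//.
have := mulr_ge0 (ltW h0) (A0 om); have := B1 om; lra.
Qed.

Lemma expectation_shiftM (Z f : Om -> R) (C a : R) : intP f ->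
  measurable_fun setT Z -> (forall om, `|Z om| <= C) ->
  \int[P]_om ((Z om + a) * f om) =
  \int[P]_om (Z om * f om) + a * \int[P]_om f om.
Proof.
move=> iF mZ ZC; have iZF := integrable_boundedM mZ ZC iF.
under eq_Rintegral do rewrite mulrDl.
by rewrite RintegralD// ?RintegralZl//; exact: integrable_EFinZl.
Qed.

Lemma expectation_shift (Z : Om -> R) (C a : R) :
  measurable_fun setT Z -> (forall om, `|Z om| <= C) ->
  \int[P]_om (Z om + a) = \int[P]_om Z om + a.
Proof.
move=> mZ ZC; rewrite RintegralD//; last exact: integrable_EFin_cst.
  by rewrite Rintegral_cst// [X in fine X]probability_setT mulr1.
exact: integrable_bounded ZC.
Qed.

(** The bracket of the scheme for test values Z and level r, before and after
    shifting them by s' and s.  By monotonicity the comparison reduces to the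
    effect of the shift, in which the term [(s' - s) * E A <= 0] is dropped and
    the B term vanishes. *)
Lemma generator_shift_le (Z Z' : Om -> R) (C C' r s s' l delta : R) :
  measurable_fun setT Z -> (forall om, `|Z om| <= C) ->
  measurable_fun setT Z' -> (forall om, `|Z' om| <= C') ->
  (forall om, Z om <= Z' om) ->
  \int[P]_om B om = 0 -> s' <= s ->
  h^-1 * (\int[P]_om (Z om + s') - (r + s)) + l - delta * (r + s)
    + \int[P]_om ((Z om + s' - (r + s)) * A om)
    + h^-1 * \int[P]_om ((Z om + s') * B om) <=
  h^-1 * (\int[P]_om Z' om - r) + l - delta * r
    + \int[P]_om ((Z' om - r) * A om) + h^-1 * \int[P]_om (Z' om * B om)
    + ((s' - s) / h - delta * s).
Proof.
move=> mZ ZC mZ' ZC' ZZ' EB0 s's.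
have EA0 : 0 <= \int[P]_om A om by exact: Rintegral_ge0.
under [X in _ + X + _ * _ <= _]eq_Rintegral do rewrite -addrA.
rewrite (expectation_shift _ mZ ZC) !(expectation_shiftM _ _ mZ ZC)//.
rewrite (expectation_shiftM _ _ mZ' ZC')// EB0.
have := expectation_weight_le mZ ZC mZ' ZC' ZZ'.
move: (\int[P]_om (Z om * A om)) (\int[P]_om (Z' om * A om)) => ZA Z'A.
move: (\int[P]_om (Z om * B om)) (\int[P]_om (Z' om * B om)) => ZB Z'B.
move: (\int[P]_om Z om) (\int[P]_om Z' om) (\int[P]_om A om) EA0.
move=> EZ EZ' EA EA0 main.
have main' : h^-1 * EZ + ZA + h^-1 * ZB <= h^-1 * EZ' + Z'A + h^-1 * Z'B.
  rewrite -(ler_pM2l h0) !mulrDr !mulrA divff ?gt_eqF// !mul1r.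
  exact: main.
have : (s' - s) * EA <= 0 by rewrite mulr_le0_ge0// subr_le0.
lra.
Qed.

End WeightedExpectation.

(** * Decay of the time function *)

Section ThetaBound.
Context (R : realType).

(** With y = 2Ch <= 1, [1 - expR (-y) >= y / (1 + y) >= y / 2]; the condition
    on h is a convenient way to have y <= 1 that also covers C = 0. *)
Lemma expR_decay_ge (C h : R) : 0 <= C -> 0 < h -> h <= (2 * C + 1)^-1 ->
  C * h <= 1 - expR (- (2 * C * h)).
Proof.
move=> C0 h0 hC.
have y1 : 2 * C * h <= 1.
  apply: (@le_trans _ _ (2 * C * (2 * C + 1)^-1)).
    by rewrite ler_wpM2l// mulr_ge0.
  by rewrite ler_pdivrMr; lra.
set y := 2 * C * h in y1 *.
have y0 : 0 <= y by rewrite /y !mulr_ge0// ltW.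
have ey := expR_ge1Dx y.
have e0 := expR_gt0 (- y).
have ee : expR (- y) * expR y = 1 by rewrite -expRD addNr expR0.
have : C * h = y / 2 by rewrite /y; field.
move=> ->; have : expR (- y) * (1 + y) <= expR (- y) * expR y.
  by rewrite ler_wpM2l// ltW.
rewrite ee => ?.
nra.
Qed.

(** The exponential factor of rate 2C decreases fast enough over a step to pay
    for the zero-order term [C * theta t], except for its constant part C c.
    The linear factor decreases by bh over a step, and its coefficient
    [expR (2 * C * (T - (t + h)))] is at least 1 because t + h <= T. *)
Lemma theta_decay (C h a b c T t : R) : 0 <= C -> 0 < h ->
  h <= (2 * C + 1)^-1 -> 0 <= a -> 0 <= b -> 0 <= c -> t + h <= T ->
  let theta := fun t : R => expR (2 * C * (T - t)) * (a + b * (T - t)) + c in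
  [/\ 0 <= theta t, theta (t + h) <= theta t &
      (theta (t + h) - theta t) / h + C * theta t <= - (b / 2) + C * c].
Proof.
move=> C0 h0 hC a0 b0 c0 thT theta; rewrite /theta.
have decay := expR_decay_ge C0 h0 hC.
have -> : expR (2 * C * (T - (t + h))) =
    expR (2 * C * (T - t)) * expR (- (2 * C * h)).
  by rewrite -expRD; congr expR; ring.
have E1 : 1 <= expR (2 * C * (T - t)) * expR (- (2 * C * h)).
  rewrite -expRD -[leLHS]expR0 ler_expR -mulrBr mulr_ge0; lra.
have q0 := expR_gt0 (- (2 * C * h)).
set q := expR (- _) in decay E1 q0 *; set E := expR _ in E1 *.
have E0 : 0 < E by exact: expR_gt0.
set tau := T - t.
have tauE : T - (t + h) = tau - h by rewrite /tau; lra.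
rewrite tauE; have tauh : h <= tau by rewrite /tau; lra.
have S0 : 0 <= a + b * tau by rewrite addr_ge0// mulr_ge0//; lra.
have Ch0 : 0 <= C * h by rewrite mulr_ge0// ltW.
have key : E * q * (a + b * (tau - h)) - E * (a + b * tau) <=
    - (C * h * (E * (a + b * tau))) - b * h.
  have h1 : 0 <= E * (a + b * tau) * (1 - q - C * h).
    by apply: mulr_ge0; [exact: mulr_ge0 (ltW E0) S0|lra].
  have h2 : 0 <= (b * h) * (E * q - 1).
    by apply: mulr_ge0; [exact: mulr_ge0 b0 (ltW h0)|lra].
  lra.
have h3 : 0 <= C * h * (E * (a + b * tau)) by rewrite !mulr_ge0// ltW.
have bh : 0 <= b * h by rewrite mulr_ge0// ltW.
split.
- by rewrite addr_ge0// mulr_ge0// ltW.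
- lra.
- rewrite -(ler_pM2l h0) mulrDr mulrCA divff ?gt_eqF// mulr1.
  lra.
Qed.

End ThetaBound.

(** * One step of the scheme *)

Section Scheme.
Context (R : realType) (disp : measure_display) (Om : measurableType disp)
  (P : probability Om R) (M : finType) (d p q : nat)
  (pb : problem R M d p) (dc : decomposition R M d p q)
  (W : R -> Om -> 'cV[R]_d) (k : nat).
Hypothesis bm : brownian_motion P W.
Hypothesis tr_le : forall m x u, ctrl pb u ->
  \tr (Sig dc m x u *m (Sig dc m x u)^T) <= (4 * k + 2)%:R.
Context (t h : R).
Hypotheses (t0 : 0 <= t) (h0 : 0 < h).
Implicit Types (x : 'cV[R]_d) (u : 'cV[R]_p) (m : M).

Let mincr := measurable_incr bm t0 h0.

Lemma measurable_euler_step m x i :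
  measurable_fun setT (fun om => euler_step dc W t h m x om i 0).
Proof.
rewrite (_ : (fun om => _) = fun om => (x i 0 + h * drift0 dc m x i 0) +
    \sum_j vol0 dc m x i j * incr W t h om j 0); last first.
  by apply/funext => om; rewrite !mxE.
apply: measurable_funD => //; apply: measurable_sum => j.
exact: measurable_funM.
Qed.

Section Step.
Context (m : M) (x : 'cV[R]_d).
Let Z (phi : 'cV[R]_d -> R) om := phi (euler_step dc W t h m x om).

Let mZ phi : bounded_continuous phi -> measurable_fun setT (Z phi).
Proof.
move=> [cphi _].
exact: (measurable_continuous_cV (measurable_euler_step m x) cphi).
Qed.

Section Control.
Context (u : 'cV[R]_p).
Hypothesis ctrl_u : ctrl pb u.
Let A om := P1 (gvec dc m x u) (h^-1 *: incr W t h om).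
Let B om := P2 k (Sig dc m x u) ((Num.sqrt h)^-1 *: incr W t h om).

Let iA : P.-integrable setT (EFin \o A).
Proof. exact: (integrable_P1 h0 mincr (incr_law bm t0 h0)). Qed.

Let iB : P.-integrable setT (EFin \o B).
Proof.
exact: (integrable_P2 h0 mincr (incr_independent bm t0 h0) (incr_law bm t0 h0)).
Qed.

Let EB0 : \int[P]_om B om = 0.
Proof.
exact: (expectation_P2 h0 mincr (incr_independent bm t0 h0) (incr_law bm t0 h0)).
Qed.

Let A0 om : 0 <= A om. Proof. exact: P1_ge0. Qed.

Let B1 om : -1 <= B om. Proof. by apply: P2_geN1; exact: tr_le. Qed.

Lemma K_value_shift_le (phi phi' : 'cV[R]_d -> R) (r s s' : R) :
  bounded_continuous phi -> bounded_continuous phi' ->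
  (forall y, phi y <= phi' y) -> s' <= s ->
  h^-1 * (D0 P dc W t h m (fun y => phi y + s') x - (r + s))
    + cost pb m x u - disc pb m x u * (r + s)
    + D1 P dc W t h m (gvec dc m x u) (r + s) (fun y => phi y + s') x
    + D2 P dc W k t h m (Sig dc m x u) (fun y => phi y + s') x <=
  h^-1 * (D0 P dc W t h m phi' x - r) + cost pb m x u - disc pb m x u * r
    + D1 P dc W t h m (gvec dc m x u) r phi' x
    + D2 P dc W k t h m (Sig dc m x u) phi' x
    + ((s' - s) / h - disc pb m x u * s).
Proof.
move=> bphi bphi' phi_le s's.
have [[_ [C phiC]] [_ [C' phiC']]] := (bphi, bphi').
rewrite /D0 /D1 /D2 !fine_expectationE.
exact: (@generator_shift_le _ _ _ P A B h h0 iA iB A0 B1 (Z phi) (Z phi') C C'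
  r s s' _ _ (mZ bphi) (fun om => phiC _) (mZ bphi') (fun om => phiC' _)
  (fun om => phi_le _) EB0 s's).
Qed.

Lemma TN_le (phi phi' : 'cV[R]_d -> R) :
  bounded_continuous phi -> bounded_continuous phi' ->
  (forall y, phi y <= phi' y) ->
  TN P pb dc W k t h m u phi x <= TN P pb dc W k t h m u phi' x.
Proof.
move=> bphi bphi' phi_le.
have [[_ [C phiC]] [_ [C' phiC']]] := (bphi, bphi').
have := @expectation_weight_le _ _ _ P A B h h0 iA iB A0 B1 (Z phi) (Z phi') C C'
  (mZ bphi) (fun om => phiC _) (mZ bphi') (fun om => phiC' _)
  (fun om => phi_le _).
have subA psi :
    \int[P]_om ((Z psi om - 0) * A om) = \int[P]_om (Z psi om * A om).
  by apply: eq_Rintegral => om _; rewrite subr0.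
rewrite /TN /D0 /D1 /D2 !fine_expectationE (subA phi) (subA phi').
rewrite !mulrDr !mulrA divff ?gt_eqF// !mul1r /Z /A /B; lra.
Qed.

(** [h C < 1/2] under this condition on h, so the discount term, which is at
    least [- h C], cannot cancel the 1; the P1 term only helps. *)
Lemma TD_gt0 (C : R) : 0 <= C -> - C <= disc pb m x u ->
  h <= (2 * C + 1)^-1 -> 0 < TD P pb dc W t h m u x.
Proof.
move=> C0 disc_ge hC; rewrite /TD fine_expectationE.
have EA0 : 0 <= \int[P]_om A om by exact: Rintegral_ge0.
have hEA : 0 <= h * \int[P]_om A om by rewrite mulr_ge0// ltW.
have h2C : h * (2 * C + 1) <= 1.
  have C1 : 0 < 2 * C + 1 by lra.
  by rewrite -ler_pdivlMr// mul1r.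
have hdisc : - (h * C) <= h * disc pb m x u by rewrite -mulrN ler_pM2l.
have hC0 : 0 <= h * C by rewrite mulr_ge0// ltW.
have h1 : 0 < h by [].
rewrite -[\int[P]_om P1 _ _]/(\int[P]_om A om); lra.
Qed.

End Control.
End Step.
End Scheme.

(** Continuity on the grid times the space only sees points of the grid in the
    time direction, and moving x at a fixed grid time stays inside. *)
Lemma bounded_continuous_slice (R : realType) (d : nat) (T h t : R)
    (v : R -> 'cV[R]_d -> R) :
  grid_bounded_continuous T h v -> closed_time_grid T h t ->
  bounded_continuous (v t).
Proof.
move=> [cv [C vC]] tT; split; last by exists C => x; exact: vC.
move=> x; have /subspace_continuousP/(_ (t, x)) := cv.
move=> /(_ (conj tT Logic.I)) cvtx.
apply: (@cvg_comp _ _ _ (fun y => (t, y)) (fun z : R * 'cV[R]_d => v z.1 z.2)).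
  2: exact: cvtx.
move=> A; rewrite nbhs_simpl /within /= => -[[U V] /= [Ut Vx] UVA].
suff : nbhs x [set y | A (t, y)] by [].
apply: filterS Vx => y Vy; apply: (UVA (t, y)) => //.
by split => //=; exact: nbhs_singleton.
Qed.

Lemma time_grid_ge0 (R : realType) (T h t : R) :
  0 < h -> time_grid T h t -> 0 <= t.
Proof. by move=> h0 [n [-> _]]; rewrite mulr_ge0// ltW. Qed.

Lemma time_grid_next (R : realType) (T h t : R) :
  time_grid T h t -> closed_time_grid T h (t + h).
Proof.
move=> [n [-> nT]]; exists n.+1; split; last by rewrite -lerBrDr.
by rewrite -addn1 natrD mulrDl mul1r.
Qed.

Lemma disc_uniform_lb (R : realType) (M : finType) (d p : nat)
    (pb : problem R M d p) :
  (forall m, exists c : R, forall x u, ctrl pb u -> c <= disc pb m x u) ->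
  exists2 C : R, 0 <= C & forall m x u, ctrl pb u -> - C <= disc pb m x u.
Proof.
move=> /choice [c cP]; exists (\sum_m `|c m|); first exact: sumr_ge0.
move=> m x u uU; apply: le_trans (cP m x u uU); rewrite lerNl.
rewrite (bigD1 m)//= (le_trans (ler_norm (- c m)))// normrN lerDl.
exact: sumr_ge0.
Qed.

(** * Monotonicity of the scheme *)

Theorem theorem4p4 (R : realType) (disp : measure_display)
    (Om : measurableType disp) (P : probability Om R)
    (M : finType) (d p q : nat) (T : R)
    (pb : problem R M d p) (dc : decomposition R M d p q)
    (W : R -> Om -> 'cV[R]_d) (abar : R) (k : nat)
    (T_gt0 : 0 < T)
    (pb_cont : continuous_problem pb)
    (dec : decomposes pb dc)
    (W_brownian : brownian_motion P W)
    (tr_le : forall m x u, ctrl pb u ->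
       \tr (Sig dc m x u *m (Sig dc m x u)^T) <= abar)
    (disc_lb : forall m, exists c : R, forall x u, ctrl pb u ->
       c <= disc pb m x u)
    (abar_le : abar <= (4 * k + 2)%:R) :
  (exists lam mu h0 : R, [/\ 0 <= lam, 0 <= mu, 0 < h0 &
     forall (h : R), 0 < h -> T / h \is a Num.int -> h <= h0 ->
     forall v v' : R -> 'cV[R]_d -> R,
     grid_bounded_continuous T h v -> grid_bounded_continuous T h v' ->
     (forall t x, closed_time_grid T h t -> v t x <= v' t x) ->
     forall a b c : R, 0 <= a -> 0 <= b -> 0 <= c ->
     let theta := fun t : R => expR (mu * (T - t)) * (a + b * (T - t)) + c in
     let vtheta := fun (t : R) (x : 'cV[R]_d) => v t x + theta t in
     forall (r t : R) (x : 'cV[R]_d), time_grid T h t ->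
     has_max (K_values P pb dc W k h t x (r + theta t) vtheta) ->
     has_max (K_values P pb dc W k h t x r v') ->
     K P pb dc W k h t x (r + theta t) vtheta >=
       K P pb dc W k h t x r v' + b / 2 - lam * c])
  /\
  (exists2 h0 : R, 0 < h0 &
     forall (h : R), 0 < h -> T / h \is a Num.int -> h <= h0 ->
     forall t : R, time_grid T h t ->
     forall phi phi' : 'cV[R]_d -> R,
     bounded_continuous phi -> bounded_continuous phi' ->
     (forall x, phi x <= phi' x) ->
     forall x : 'cV[R]_d,
     has_max (T_values P pb dc W k t h phi x) ->
     has_max (T_values P pb dc W k t h phi' x) ->
     T_op P pb dc W k t h phi x <= T_op P pb dc W k t h phi' x).
Proof.
have tr_le' m x u : ctrl pb u ->
    \tr (Sig dc m x u *m (Sig dc m x u)^T) <= (4 * k + 2)%:R.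
  by move=> uU; exact: le_trans (tr_le m x u uU) abar_le.
have [C C0 disc_ge] := disc_uniform_lb disc_lb.
have h00 : 0 < (2 * C + 1)^-1 by rewrite invr_gt0; lra.
split.
- exists C, (2 * C), (2 * C + 1)^-1; split => //; first by rewrite mulr_ge0.
  move=> h h0 _ hC v v' bv bv' vv' a b c a0 b0 c0 theta vtheta r t x tT max1 max2.
  have thT := time_grid_next tT.
  have t0 := time_grid_ge0 h0 tT.
  have tT' : t + h <= T by case: thT => n [].
  have [theta0 theta_le theta_dec] := theta_decay C0 h0 hC a0 b0 c0 tT'.
  rewrite -/theta in theta0 theta_le theta_dec.
  suff : max_of (K_values P pb dc W k h t x (r + theta t) vtheta) <=
      max_of (K_values P pb dc W k h t x r v') + (- (b / 2) + C * c).
    by rewrite /K; lra.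
  apply: max_of_le => // _ [m [u uU ->]].
  eexists; first by exists m, u.
  have := K_value_shift_le W_brownian tr_le' t0 h0 m x uU r
    (bounded_continuous_slice bv thT) (bounded_continuous_slice bv' thT)
    (fun y => vv' _ y thT) theta_le.
  move=> /le_trans; apply; rewrite lerD2l.
  apply: le_trans theta_dec; rewrite lerD2l.
  by rewrite -mulNr ler_wpM2r// lerNl disc_ge.
- exists (2 * C + 1)^-1 => // h h0 _ hC t tT phi phi' bphi bphi' phi_le x max1 max2.
  have t0 := time_grid_ge0 h0 tT.
  rewrite /T_op -[leRHS]addr0; apply: max_of_le => // _ [m [u uU ->]].
  eexists; first by exists m, u.
  rewrite addr0 ler_pM2r; last first.
    by rewrite invr_gt0; exact: TD_gt0 (disc_ge m x u uU) hC.
  exact: TN_le.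
Qed.
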